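(* (i) The category of points of the scaling topos $\mathrm{Sh}(C,J)$ with support $\{0\}$ is the same as (i.e. canonically equivalent to) the category of points of the topos $\widehat{\mathbb{N}^\times}$. (ii) The category of points of the scaling topos $\mathrm{Sh}(C,J)$ with support different from $\{0\}$ is canonically equivalent to the category of rank one subgroups of $\mathbb{R}$.
   Context: $\mathbb{N}^\times$ is the multiplicative monoid of positive integers. $C$ is the category whose objects are the (possibly empty) bounded open intervals $\Omega\subset[0,\infty)$ (open in the topology of $[0,\infty)$, so intervals $[0,a)$ are allowed). Morphisms are $\mathrm{Hom}_C(\Omega,\Omega')=\{n\in\mathbb{N}^\times\mid n\Omega\subset\Omega'\}$ if $\Omega\neq\emptyset$, and $\mathrm{Hom}_C(\emptyset,\Omega')=\{*\}$ is a one point set; composition of morphisms between non-empty objects is multiplication of integers. $J$ is the Grothendieck topology on $C$ generated by the basis which assigns to each object $\Omega$ all ordinary open covers $\{\Omega_i\subset\Omega,\ i\in I\mid \bigcup_i\Omega_i=\Omega\}$ of $\Omega$ by objects of $C$. The scaling topos is the category $\mathrm{Sh}(C,J)$ of sheaves of sets on $(C,J)$. Points of $\mathrm{Sh}(C,J)$ are identified with flat continuous (covariant) functors $F:C\to\mathrm{Sets}$, with natural transformations as morphisms. Flat means that the category of elements $\int_C F$ is filtering: it is non-empty; for any $x\in F(\Omega)$, $x'\in F(\Omega')$ there are an object $W$, an element $w\in F(W)$ and morphisms $u:W\to\Omega$, $u':W\to\Omega'$ with $F(u)w=x$, $F(u')w=x'$; and for $u,v:\Omega\to\Omega'$ and $x\in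 F(\Omega)$ with $F(u)x=F(v)x$ there are $w:W\to\Omega$ and $z\in F(W)$ with $F(w)z=x$ and $u\circ w=v\circ w$. Continuous means that $F$ sends covers to jointly surjective families. The support of a point $F$ is the complement in $[0,\infty)$ of the union of the open intervals $I$ (objects of $C$) such that $F(I)=\emptyset$. $\widehat{\mathbb{N}^\times}$ is the topos of presheaves of sets on the one-object category associated to the monoid $\mathbb{N}^\times$ (sets with an action of $\mathbb{N}^\times$); its points are identified with flat functors $\mathbb{N}^\times\to\mathrm{Sets}$, with natural transformations as morphisms. A rank one subgroup of $\mathbb{R}$ is a non-zero subgroup $H\subset\mathbb{R}$ which is isomorphic, as an abstract group, to a subgroup of $\mathbb{Q}$; the morphisms in the category of rank one subgroups of $\mathbb{R}$ are the inclusions. *)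

(* Defs.v *)
From mathcomp Require Import all_boot all_order all_algebra.
From mathcomp Require Import all_classical all_reals.
From mathcomp Require Import topology normedtype.

Set Implicit Arguments.
Unset Strict Implicit.
Unset Printing Implicit Defensive.

Import Order.TTheory GRing.Theory Num.Theory.
Import numFieldNormedType.Exports.

Local Open Scope classical_set_scope.
Local Open Scope ring_scope.

(** * Categories *)

Record category := Category {
  ob :> Type;
  mor : ob -> ob -> Type;
  idm : forall a, mor a a;
  cmp : forall a b c, mor b c -> mor a b -> mor a c;
  cmp_idl : forall a b (f : mor a b), cmp (idm b) f = f;
  cmp_idr : forall a b (f : mor a b), cmp f (idm a) = f;
  cmpA : forall a b c d (h : mor c d) (g : mor b c) (f : mor a b),
    cmp h (cmp g f) = cmp (cmp h g) f }.

Arguments mor {_} _ _.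
Arguments idm {_} _.
Arguments cmp {_ _ _ _} _ _.

Record functor (C D : category) := Functor {
  fob :> C -> D;
  fmor : forall a b, mor a b -> mor (fob a) (fob b);
  fmor_id : forall a, fmor (idm a) = idm (fob a);
  fmor_cmp : forall a b c (g : mor b c) (f : mor a b),
    fmor (cmp g f) = cmp (fmor g) (fmor f) }.

Arguments fmor {_ _} _ {_ _} _.

Definition id_functor (C : category) : functor C C :=
  @Functor C C (fun a => a) (fun _ _ f => f)
    (fun _ => erefl) (fun _ _ _ _ _ => erefl).

Section CompFunctor.
Variables (C D E : category) (G : functor D E) (F : functor C D).

Lemma comp_functor_id a : fmor G (fmor F (idm a)) = idm (G (F a)).
Proof. by rewrite !fmor_id. Qed.

Lemma comp_functor_cmp a b c (g : mor b c) (f : mor a b) :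
  fmor G (fmor F (cmp g f)) = cmp (fmor G (fmor F g)) (fmor G (fmor F f)).
Proof. by rewrite !fmor_cmp. Qed.

Definition comp_functor : functor C E :=
  @Functor C E (fun a => G (F a)) (fun _ _ f => fmor G (fmor F f))
    comp_functor_id comp_functor_cmp.

End CompFunctor.

Record nattrans (C D : category) (F G : functor C D) := NatTrans {
  ntc :> forall a, mor (F a) (G a);
  ntc_natural : forall a b (f : mor a b),
    cmp (ntc b) (fmor F f) = cmp (fmor G f) (ntc a) }.

Section FunctorCategory.
Variables C D : category.
Implicit Types F G H K : functor C D.

Lemma nattrans_eq F G (s t : nattrans F G) : (forall a, s a = t a) -> s = t.
Proof.
case: s t => [s ns] [t nt] /= st.
have e : s = t by apply: functional_extensionality_dep.
by subst t; congr NatTrans; exact: Prop_irrelevance.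
Qed.

Lemma id_natural F a b (f : mor a b) :
  cmp (idm (F b)) (fmor F f) = cmp (fmor F f) (idm (F a)).
Proof. by rewrite cmp_idl cmp_idr. Qed.

Definition id_nattrans F : nattrans F F := NatTrans (@id_natural F).

Lemma comp_natural F G H (t : nattrans G H) (s : nattrans F G)
    a b (f : mor a b) :
  cmp (cmp (t b) (s b)) (fmor F f) = cmp (fmor H f) (cmp (t a) (s a)).
Proof. by rewrite -cmpA ntc_natural cmpA ntc_natural cmpA. Qed.

Definition comp_nattrans F G H (t : nattrans G H) (s : nattrans F G) :
  nattrans F H := NatTrans (comp_natural t s).

Lemma comp_nattrans_idl F G (s : nattrans F G) :
  comp_nattrans (id_nattrans G) s = s.
Proof. by apply: nattrans_eq => a /=; exact: cmp_idl. Qed.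

Lemma comp_nattrans_idr F G (s : nattrans F G) :
  comp_nattrans s (id_nattrans F) = s.
Proof. by apply: nattrans_eq => a /=; exact: cmp_idr. Qed.

Lemma comp_nattransA F G H K
    (u : nattrans H K) (t : nattrans G H) (s : nattrans F G) :
  comp_nattrans u (comp_nattrans t s) = comp_nattrans (comp_nattrans u t) s.
Proof. by apply: nattrans_eq => a /=; exact: cmpA. Qed.

Definition functor_cat : category :=
  @Category (functor C D) (@nattrans C D) id_nattrans comp_nattrans
    comp_nattrans_idl comp_nattrans_idr comp_nattransA.

End FunctorCategory.

Definition full_subcategory (C : category) (P : C -> Prop) : category :=
  @Category {a : C | P a} (fun a b => mor (sval a) (sval b))
    (fun a => idm (sval a)) (fun _ _ _ g f => cmp g f)
    (fun _ _ f => cmp_idl f) (fun _ _ f => cmp_idr f)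
    (fun _ _ _ _ h g f => cmpA h g f).

Definition full_inclusion (C : category) (P : C -> Prop) :
    functor (full_subcategory P) C :=
  @Functor (full_subcategory P) C (fun a => sval a) (fun _ _ f => f)
    (fun _ => erefl) (fun _ _ _ _ _ => erefl).

Definition isomorphic (C : category) (a b : C) : Prop :=
  exists (f : mor a b) (g : mor b a), cmp g f = idm a /\ cmp f g = idm b.

Definition is_equivalence (C D : category) (F : functor C D) : Prop :=
  exists G : functor D C,
    isomorphic (comp_functor G F : functor_cat C C) (id_functor C) /\
    isomorphic (comp_functor F G : functor_cat D D) (id_functor D).

Definition Sets : category :=
  @Category Type (fun A B => A -> B) (fun _ x => x) (fun _ _ _ g f x => g (f x))
    (fun _ _ _ => erefl) (fun _ _ _ => erefl) (fun _ _ _ _ _ _ _ => erefl).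

(** The category of elements of [F] is filtering. *)
Definition flat (C : category) (F : functor C Sets) : Prop :=
  [/\ exists a : C, inhabited (F a),
      forall (a a' : C) (x : F a) (x' : F a'),
        exists (b : C) (w : F b) (u : mor b a) (u' : mor b a'),
          fmor F u w = x /\ fmor F u' w = x'
    & forall (a b : C) (u v : mor a b) (x : F a), fmor F u x = fmor F v x ->
        exists (c : C) (w : mor c a) (z : F c),
          fmor F w z = x /\ cmp u w = cmp v w].

(** * The monoid of positive integers and the points of its presheaf topos *)

Definition posint := {n : nat | (0 < n)%N}.

Definition one_posint : posint := exist _ 1%N isT.

Lemma mul_posint_gt0 (m n : posint) : (0 < val m * val n)%N.
Proof. by rewrite muln_gt0 (valP m) (valP n). Qed.

Definition mul_posint (m n : posint) : posint :=
  exist _ (val m * val n)%N (mul_posint_gt0 m n).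

Lemma mul1_posint n : mul_posint one_posint n = n.
Proof. by apply: val_inj; rewrite /= mul1n. Qed.

Lemma mul_posint1 n : mul_posint n one_posint = n.
Proof. by apply: val_inj; rewrite /= muln1. Qed.

Lemma mul_posintA m n p :
  mul_posint m (mul_posint n p) = mul_posint (mul_posint m n) p.
Proof. by apply: val_inj; rewrite /= mulnA. Qed.

Definition Ntimes : category :=
  @Category unit (fun _ _ => posint) (fun _ => one_posint)
    (fun _ _ _ => mul_posint)
    (fun _ _ => mul1_posint) (fun _ _ => mul_posint1)
    (fun _ _ _ _ => mul_posintA).

Definition Ntimes_points : category :=
  full_subcategory (fun X : functor_cat Ntimes Sets => flat X).

Section Scaling.
Variable R : realType.

(** * The site *)

Record intvl := Intvl {
  pts :> set R;
  intvl_is_interval : is_interval pts;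
  intvl_bounded : bounded_set pts;
  intvl_open : exists2 U : set R, open U & pts = U `&` `[0, +oo[ }.

(* [ScalEmpty] is the only morphism out of the empty interval. *)
Inductive scal (A B : intvl) : Type :=
| ScalEmpty of A = set0 :> set R
| ScalMul (n : posint) of
    A !=set0 & (forall x : R, pts A x -> pts B ((val n)%:R * x)).

Definition scal_mult (A B : intvl) (f : scal A B) : posint :=
  match f with
  | ScalEmpty _ => one_posint
  | ScalMul n _ _ => n
  end.

Lemma scal_mult_in (A B : intvl) (f : scal A B) (x : R) :
  pts A x -> pts B ((val (scal_mult f))%:R * x).
Proof. by case: f => [A0|n _ nAB] Ax /=; [move: Ax; rewrite A0|exact: nAB]. Qed.

Lemma scal_eq (A B : intvl) (f g : scal A B) :
  (A !=set0 -> scal_mult f = scal_mult g) -> f = g.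
Proof.
case: f g => [A0|n An nAB] [A0'|m Am mAB] /= fg.
- by congr ScalEmpty; exact: Prop_irrelevance.
- by exfalso; case: Am => x; rewrite A0.
- by exfalso; case: An => x; rewrite A0'.
- have e := fg An; subst m.
  by congr ScalMul; exact: Prop_irrelevance.
Qed.

Lemma scal_id_in (A : intvl) (x : R) :
  pts A x -> pts A ((val one_posint)%:R * x).
Proof. by rewrite mul1r. Qed.

Definition scal_id (A : intvl) : scal A A :=
  match pselect (A !=set0) with
  | left A0 => ScalMul A0 (@scal_id_in A)
  | right A0 => ScalEmpty A ((nonemptyPn A).1 A0)
  end.

Lemma scal_mul_in (A B D : intvl) (g : scal B D) (n : posint) :
  (forall x : R, pts A x -> pts B ((val n)%:R * x)) ->
  forall x : R, pts A x ->
    pts D ((val (mul_posint (scal_mult g) n))%:R * x).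
Proof. by move=> nAB x /nAB /(scal_mult_in g); rewrite mulrA -natrM. Qed.

Definition scal_comp (A B D : intvl) (g : scal B D) (f : scal A B) :
    scal A D :=
  match f with
  | ScalEmpty A0 => ScalEmpty D A0
  | ScalMul n A0 nAB => ScalMul A0 (scal_mul_in g nAB)
  end.

Lemma scal_mult_id (A : intvl) : scal_mult (scal_id A) = one_posint.
Proof. by rewrite /scal_id; case: pselect. Qed.

Lemma scal_mult_comp (A B D : intvl) (g : scal B D) (f : scal A B) :
  A !=set0 ->
  scal_mult (scal_comp g f) = mul_posint (scal_mult g) (scal_mult f).
Proof. by case: f => [A0 [x]|n An nAB _] //; rewrite A0. Qed.

Lemma scal_nonempty (A B : intvl) (f : scal A B) : A !=set0 -> B !=set0.
Proof. by case=> x /(scal_mult_in f) Bx; eexists; exact: Bx. Qed.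

Lemma scal_comp_idl (A B : intvl) (f : scal A B) : scal_comp (scal_id B) f = f.
Proof.
by apply: scal_eq => A0; rewrite scal_mult_comp// scal_mult_id mul1_posint.
Qed.

Lemma scal_comp_idr (A B : intvl) (f : scal A B) : scal_comp f (scal_id A) = f.
Proof.
by apply: scal_eq => A0; rewrite scal_mult_comp// scal_mult_id mul_posint1.
Qed.

Lemma scal_compA (A B D E : intvl)
    (h : scal D E) (g : scal B D) (f : scal A B) :
  scal_comp h (scal_comp g f) = scal_comp (scal_comp h g) f.
Proof.
apply: scal_eq => A0; have B0 := scal_nonempty f A0.
by rewrite !scal_mult_comp// mul_posintA.
Qed.

Definition scalC : category :=
  @Category intvl scal scal_id scal_comp
    scal_comp_idl scal_comp_idr scal_compA.

(* A family of morphisms of multiplier 1 is a family of inclusions. *)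
Definition open_cover (A : scalC) (I : Type) (U : I -> scalC)
    (u : forall i, mor (U i) A) : Prop :=
  (forall i, scal_mult (u i) = one_posint) /\
  \bigcup_i (U i : set R) = A :> set R.

Definition cover_continuous (F : functor scalC Sets) : Prop :=
  forall (A : scalC) (I : Type) (U : I -> scalC) (u : forall i, mor (U i) A),
    open_cover u -> forall x : F A, exists (i : I) (y : F (U i)),
      fmor F (u i) y = x.

Definition is_point (F : functor_cat scalC Sets) : Prop :=
  flat F /\ cover_continuous F.

Definition pt_support (F : functor scalC Sets) : set R :=
  `[0, +oo[ `\` \bigcup_(A in [set A : intvl | ~ inhabited (F A)]) A.

Definition points_support0 : category :=
  full_subcategory
    (fun F : functor_cat scalC Sets => is_point F /\ pt_support F = [set 0]).

Definition points_support_neq0 : category :=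
  full_subcategory
    (fun F : functor_cat scalC Sets => is_point F /\ pt_support F <> [set 0]).

(** * Rank one subgroups *)

Definition is_subgroup (V : zmodType) (H : set V) : Prop :=
  H 0 /\ forall x y, H x -> H y -> H (x - y).

Definition rank_one (H : set R) : Prop :=
  [/\ is_subgroup H, H <> [set 0]
    & exists (K : set rat) (f : R -> rat),
      [/\ is_subgroup K, set_bij H K f
        & forall x y, H x -> H y -> f (x + y) = f x + f y]].

Definition rank_one_subgroups : category :=
  @Category {H : set R | rank_one H} (fun H H' => sval H `<=` sval H')
    (fun _ => @subset_refl _ _)
    (fun _ _ _ H23 H12 => subset_trans H12 H23)
    (fun _ _ _ => Prop_irrelevance _ _)
    (fun _ _ _ => Prop_irrelevance _ _)
    (fun _ _ _ _ _ _ _ => Prop_irrelevance _ _).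

(** * The functors realizing the canonical equivalences *)

Lemma fiber_eq (T : Type) (P : T -> Prop) (x y : {t | P t}) :
  sval x = sval y -> x = y.
Proof. by case: x y => [x Px] [y Py] /= e; exact: eq_exist. Qed.

(* For an [Ntimes]-set [X], the functor with value [X] on the intervals
   containing 0 and the empty set on the others. *)
Section AtZero.
Variable X : functor Ntimes Sets.

Definition at_zero_ob (A : scalC) : Sets := {_ : X tt | pts A 0}.

Lemma scal_zero_in (A B : intvl) (f : scal A B) : pts A 0 -> pts B 0.
Proof. by move/(scal_mult_in f); rewrite mulr0. Qed.

Definition at_zero_map (A B : scalC) (f : mor A B) :
    mor (at_zero_ob A) (at_zero_ob B) :=
  fun x => exist _ (@fmor _ _ X tt tt (scal_mult f) (sval x))
                   (scal_zero_in f (svalP x)).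

Lemma at_zero_id A : at_zero_map (idm A) = idm (at_zero_ob A).
Proof.
apply/funext => x; apply: fiber_eq; rewrite /= scal_mult_id.
by rewrite -[one_posint]/(@idm Ntimes tt) fmor_id.
Qed.

Lemma at_zero_cmp A B D (g : mor B D) (f : mor A B) :
  at_zero_map (cmp g f) = cmp (at_zero_map g) (at_zero_map f).
Proof.
apply/funext => x; apply: fiber_eq; rewrite /= scal_mult_comp; last first.
  by exists 0; exact: (svalP x).
rewrite -[mul_posint _ _]/(@cmp Ntimes tt tt tt (scal_mult g) (scal_mult f)).
by rewrite fmor_cmp.
Qed.

Definition at_zero : functor scalC Sets := Functor at_zero_id at_zero_cmp.

End AtZero.

Section AtZeroMap.
Variables (X Y : functor Ntimes Sets) (t : nattrans X Y).

Definition at_zero_trans_map (A : scalC) : mor (at_zero X A) (at_zero Y A) :=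
  fun x => exist _ (t tt (sval x)) (svalP x).

Lemma at_zero_trans_natural (A B : scalC) (f : mor A B) :
  cmp (@at_zero_trans_map B) (fmor (at_zero X) f) =
  cmp (fmor (at_zero Y) f) (@at_zero_trans_map A).
Proof.
apply/funext => x; apply: fiber_eq => /=.
exact: (congr1 (@^~ (sval x)) (@ntc_natural _ _ _ _ t tt tt (scal_mult f))).
Qed.

Definition at_zero_trans : nattrans (at_zero X) (at_zero Y) :=
  NatTrans at_zero_trans_natural.

End AtZeroMap.

Lemma at_zero_trans_id (X : functor_cat Ntimes Sets) :
  at_zero_trans (@idm (functor_cat Ntimes Sets) X) =
  @idm (functor_cat scalC Sets) (at_zero X).
Proof. by apply: nattrans_eq => A; apply/funext => x; exact: fiber_eq. Qed.

Lemma at_zero_trans_cmp (X Y Z : functor_cat Ntimes Sets)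
    (t : mor Y Z) (s : mor X Y) :
  at_zero_trans (cmp t s) =
  @cmp (functor_cat scalC Sets) _ _ _ (at_zero_trans t) (at_zero_trans s).
Proof. by apply: nattrans_eq => A; apply/funext => x; exact: fiber_eq. Qed.

Definition at_zero_functor :
    functor (functor_cat Ntimes Sets) (functor_cat scalC Sets) :=
  @Functor (functor_cat Ntimes Sets) (functor_cat scalC Sets) at_zero at_zero_trans
    at_zero_trans_id at_zero_trans_cmp.

(* The functor mapping [A] to the set of positive
   elements of [H] lying in [A]. *)
Section Trace.
Variable H : rank_one_subgroups.

Definition trace_ob (A : scalC) : Sets :=
  {x : R | [/\ sval H x, 0 < x & pts A x]}.

Lemma is_subgroup_muln (V : zmodType) (K : set V) (x : V) n :
  is_subgroup K -> K x -> K (x *+ n).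
Proof.
move=> [K0 KB] Kx; elim: n => [|n IHn]; first by rewrite mulr0n.
have KN : K (- x) by rewrite -sub0r; exact: KB.
by rewrite mulrSr -[x in _ + x]opprK; exact: KB.
Qed.

Lemma trace_in (A B : scalC) (f : mor A B) (x : R) :
  [/\ sval H x, 0 < x & pts A x] ->
  let y := (val (scal_mult f))%:R * x in [/\ sval H y, 0 < y & pts B y].
Proof.
move=> [Hx x0 Ax] /=; split; last exact: scal_mult_in.
- rewrite mulr_natl; apply: is_subgroup_muln => //.
  by case: (svalP H).
- by rewrite mulr_gt0// ltr0n (valP (scal_mult f)).
Qed.

Definition trace_map (A B : scalC) (f : mor A B) :
    mor (trace_ob A) (trace_ob B) :=
  fun x => exist _ ((val (scal_mult f))%:R * sval x) (trace_in f (svalP x)).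

Lemma trace_id A : trace_map (idm A) = idm (trace_ob A).
Proof.
by apply/funext => x; apply: fiber_eq; rewrite /= scal_mult_id mul1r.
Qed.

Lemma trace_cmp A B D (g : mor B D) (f : mor A B) :
  trace_map (cmp g f) = cmp (trace_map g) (trace_map f).
Proof.
apply/funext => x; apply: fiber_eq; rewrite /= scal_mult_comp; last first.
  by case: (svalP x) => _ _ Ax; eexists; exact: Ax.
by rewrite /= natrM mulrA.
Qed.

Definition trace : functor scalC Sets := Functor trace_id trace_cmp.

End Trace.

Section TraceMap.
Variables (H K : rank_one_subgroups) (HK : mor H K).

Lemma trace_trans_in (A : scalC) (x : R) :
  [/\ sval H x, 0 < x & pts A x] -> [/\ sval K x, 0 < x & pts A x].
Proof. by case=> Hx x0 Ax; split=> //; exact: HK. Qed.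

Definition trace_trans_map (A : scalC) : mor (trace H A) (trace K A) :=
  fun x => exist _ (sval x) (trace_trans_in (svalP x)).

Lemma trace_trans_natural (A B : scalC) (f : mor A B) :
  cmp (@trace_trans_map B) (fmor (trace H) f) =
  cmp (fmor (trace K) f) (@trace_trans_map A).
Proof. by apply/funext => x; exact: fiber_eq. Qed.

Definition trace_trans : nattrans (trace H) (trace K) :=
  NatTrans trace_trans_natural.

End TraceMap.

Lemma trace_trans_id (H : rank_one_subgroups) :
  trace_trans (idm H) = @idm (functor_cat scalC Sets) (trace H).
Proof. by apply: nattrans_eq => A; apply/funext => x; exact: fiber_eq. Qed.

Lemma trace_trans_cmp (H K L : rank_one_subgroups) (g : mor K L) (f : mor H K) :
  trace_trans (cmp g f) =
  @cmp (functor_cat scalC Sets) _ _ _ (trace_trans g) (trace_trans f).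
Proof. by apply: nattrans_eq => A; apply/funext => x; exact: fiber_eq. Qed.

Definition trace_functor : functor rank_one_subgroups (functor_cat scalC Sets) :=
  @Functor rank_one_subgroups (functor_cat scalC Sets) trace trace_trans
    trace_trans_id trace_trans_cmp.

End Scaling.

Arguments pt_support {R} F.

(* Main.v *)
Require Import Defs.
From mathcomp Require Import all_boot all_order all_algebra.
From mathcomp Require Import all_classical all_reals.
From mathcomp Require Import topology normedtype.
From mathcomp Require Import lra.

Set Implicit Arguments.
Unset Strict Implicit.
Unset Printing Implicit Defensive.

Import Order.TTheory GRing.Theory Num.Theory.
Import numFieldNormedType.Exports.

Local Open Scope classical_set_scope.
Local Open Scope ring_scope.

(** The proof rests on the fact that an element [x] of [F A], for a point
    [F], sits over a well-defined real number [a] of [A], written [located x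
    a] below. If no [a] worked, each [a] would have a neighbourhood in [A]
    from which [x] does not come; these neighbourhoods cover [A], against
    continuity. If two worked, [x] would come from two disjoint intervals,
    and flatness would produce a nonempty interval that one integer maps
    into both. A morphism of multiplier [n] multiplies the location by [n].

    Flatness makes any two elements images of a common one, hence any two
    locations are positive integer multiples of a common location. In
    particular the locations are all zero or all positive, and these are the
    two cases of the theorem ([support0_location], [location_gt0]).

    If all locations are positive, an element of [F A] is determined by its
    location: two elements with the same location are images of a common one
    under the same integer. So [F A] is the set of locations that lie in
    [A], and the integral multiples of locations form a subgroup of the
    reals whose positive elements are exactly the locations. Its elements
    are rational multiples of any fixed location, so it has rank one.
    Conversely, in a rank one subgroup two positive elements are positive
    multiples of a common one, by Bezout's identity; this is flatness of the
    trace functor. Natural transformations between trace functors fix every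
    real number, because they are compatible with arbitrarily small
    neighbourhoods; hence they are inclusions of subgroups.

    If all locations are zero, an inclusion between intervals around zero
    induces a bijection, so that [F] amounts to its value on the interval of
    length 1 at zero; the integer [n] acts on it through multiplication to
    the interval of length [n] at zero.

    The functors [trace] and [at_zero] are fully faithful and essentially
    surjective onto the points with the prescribed support, hence
    equivalences. *)

(** * Equivalences of categories and set-valued functors *)

Lemma equivalence_of_fully_faithful (C D : category) (F : functor C D) :
  (forall a b, injective (fun f : mor a b => fmor F f)) ->
  (forall a b (g : mor (F a) (F b)), exists f : mor a b, fmor F f = g) ->
  (forall d : D, exists c : C, isomorphic (F c) d) ->
  is_equivalence F.
Proof.
move=> faith full esurj.
have [G0 iG0] := choice esurj.
pose u d : mor (F (G0 d)) d := sval (cid (iG0 d)).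
pose v d : mor d (F (G0 d)) := sval (cid (svalP (cid (iG0 d)))).
have uv d : cmp (u d) (v d) = idm d.
  by case: (svalP (cid (svalP (cid (iG0 d))))).
have vu d : cmp (v d) (u d) = idm (F (G0 d)).
  by case: (svalP (cid (svalP (cid (iG0 d))))).
pose pre a b (g : mor (F a) (F b)) := sval (cid (full a b g)).
have preE a b (g : mor (F a) (F b)) : fmor F (pre a b g) = g.
  exact: (svalP (cid (full a b g))).
pose Gm a b (g : mor a b) : mor (G0 a) (G0 b) :=
  pre _ _ (cmp (v b) (cmp g (u a))).
have GmE a b (g : mor a b) : fmor F (Gm a b g) = cmp (v b) (cmp g (u a)).
  exact: preE.
have Gid a : Gm a a (idm a) = idm (G0 a).
  by apply: faith; rewrite GmE fmor_id cmp_idl vu.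
have Gcmp a b c (g : mor b c) (f : mor a b) :
    Gm a c (cmp g f) = cmp (Gm b c g) (Gm a b f).
  apply: faith; rewrite fmor_cmp !GmE -!cmpA; congr cmp; congr cmp.
  by rewrite [RHS]cmpA uv cmp_idl.
pose G := Functor Gid Gcmp.
have uN a b (g : mor a b) :
    cmp (u b) (fmor (comp_functor F G) g) = cmp (fmor (id_functor D) g) (u a).
  by rewrite /= GmE cmpA uv cmp_idl.
have vN a b (g : mor a b) :
    cmp (v b) (fmor (id_functor D) g) = cmp (fmor (comp_functor F G) g) (v a).
  by rewrite /= GmE -!cmpA uv cmp_idr.
pose s a : mor (G (F a)) a := pre _ _ (u (F a)).
pose t a : mor a (G (F a)) := pre _ _ (v (F a)).
have sE a : fmor F (s a) = u (F a) by exact: preE.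
have tE a : fmor F (t a) = v (F a) by exact: preE.
have sN a b (f : mor a b) :
    cmp (s b) (fmor (comp_functor G F) f) = cmp (fmor (id_functor C) f) (s a).
  by apply: faith; rewrite !fmor_cmp !sE; exact: uN.
have tN a b (f : mor a b) :
    cmp (t b) (fmor (id_functor C) f) = cmp (fmor (comp_functor G F) f) (t a).
  by apply: faith; rewrite !fmor_cmp !tE; exact: vN.
exists G; split.
- exists (@NatTrans _ _ (comp_functor G F) (id_functor C) s sN),
    (@NatTrans _ _ (id_functor C) (comp_functor G F) t tN).
  split; apply: nattrans_eq => a; apply: faith => /=.
  + by rewrite fmor_cmp sE tE vu fmor_id.
  + by rewrite fmor_cmp sE tE uv fmor_id.
- exists (@NatTrans _ _ (comp_functor F G) (id_functor D) u uN),
    (@NatTrans _ _ (id_functor D) (comp_functor F G) v vN).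
  by split; apply: nattrans_eq => a /=.
Qed.

(** Inverse natural isomorphisms are obtained from a relation that is natural
    and bijective in each component; this defers all choices to one place, as
    the components of interest are only known through such relations. *)
Lemma isomorphic_of_graph (C : category) (F G : functor C Sets)
    (r : forall a, F a -> G a -> Prop) :
  (forall a x, exists y, r a x y) ->
  (forall a y, exists x, r a x y) ->
  (forall a x y y', r a x y -> r a x y' -> y = y') ->
  (forall a x x' y, r a x y -> r a x' y -> x = x') ->
  (forall a b (f : mor a b) x y, r a x y -> r b (fmor F f x) (fmor G f y)) ->
  @isomorphic (functor_cat C Sets) F G.
Proof.
move=> tot sur fct inj nat.
pose s a (x : F a) := sval (cid (tot a x)).
pose t a (y : G a) := sval (cid (sur a y)).
have sP a x : r a x (s a x) by exact: (svalP (cid (tot a x))).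
have tP a y : r a (t a y) y by exact: (svalP (cid (sur a y))).
have sN a b (f : mor a b) :
    cmp (s b : mor (F b) (G b)) (fmor F f) = cmp (fmor G f) (s a).
  by apply/funext => x; apply: (fct b (fmor F f x)); [exact: sP|exact/nat/sP].
have tN a b (f : mor a b) :
    cmp (t b : mor (G b) (F b)) (fmor G f) = cmp (fmor F f) (t a).
  apply/funext => y; apply: (inj b _ _ (fmor G f y)); first exact: tP.
  exact/nat/tP.
exists (@NatTrans _ _ F G s sN), (@NatTrans _ _ G F t tN).
split; apply: nattrans_eq => a; apply/funext => x /=.
- exact: (inj a _ _ (s a x)).
- exact: (fct a (t a x)).
Qed.

Lemma flat_isomorphic (C : category) (F G : functor C Sets) :
  @isomorphic (functor_cat C Sets) F G -> flat G -> flat F.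
Proof.
case=> s [t [ts _]] [[a0 [x0]] joint equ].
have tsE a x : t a (s a x) = x.
  exact: (congr1 (fun n : nattrans F F => n a x) ts).
have sN a b (f : mor a b) x : s b (fmor F f x) = fmor G f (s a x).
  exact: (congr1 (@^~ x) (ntc_natural s f)).
have tN a b (f : mor a b) x : t b (fmor G f x) = fmor F f (t a x).
  exact: (congr1 (@^~ x) (ntc_natural t f)).
split.
- by exists a0; constructor; exact: (t a0 x0).
- move=> a a' x x'.
  have [b [w [u [u' [ux u'x']]]]] := joint _ _ (s a x) (s a' x').
  by exists b, (t b w), u, u'; rewrite -!tN ux u'x' !tsE.
- move=> a b u v x uv.
  have [|c [w [z [wz e]]]] := equ _ _ u v (s a x); first by rewrite -!sN uv.
  by exists c, w, (t c z); rewrite -tN wz tsE.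
Qed.

(** * Intervals and their morphisms *)

Lemma mul_posintC m n : mul_posint m n = mul_posint n m.
Proof. by apply: val_inj; rewrite /= mulnC. Qed.

Lemma mul_posintI m : injective (mul_posint m).
Proof.
move=> n p /(congr1 val) /= /eqP; rewrite eqn_pmul2l ?(valP m)// => /eqP e.
exact: val_inj.
Qed.

Section Scaling.
Variable R : realType.
Implicit Types (A B : scalC R) (m n : posint).

Local Notation "n .*" := ((val n)%:R : R) (at level 2, format "n .*").

Lemma pts_ge0 A x : pts A x -> 0 <= x.
Proof.
by have [U _ ->] := intvl_open A => -[_] /=; rewrite in_itv /= andbT.
Qed.

Lemma posr_gt0 n : 0 < n.*.
Proof. by rewrite ltr0n (valP n). Qed.

(** The intersection with the half-line gives, for [l < 0 < r], a neighbourhood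
    of zero. *)
Definition seg_set (l r : R) : set R := [set x | 0 <= x /\ l < x < r].

Lemma seg_is_interval l r : is_interval (seg_set l r).
Proof.
move=> x y [x0 /andP[lx xr]] [y0 /andP[ly yr]] z /andP[xz zy].
split; first exact: le_trans xz.
by rewrite (lt_le_trans lx xz) (le_lt_trans zy yr).
Qed.

Lemma seg_bounded l r : bounded_set (seg_set l r).
Proof.
exists (Num.max 0 r); split; first exact: num_real.
move=> M; rewrite gt_max => /andP[M0 rM] x [x0 /andP[lx xr]] /=.
by rewrite ger0_norm// ltW// (lt_trans xr).
Qed.

Lemma seg_open l r : exists2 U : set R, open U & seg_set l r = U `&` `[0, +oo[.
Proof.
exists `]l, r[%classic; first exact: interval_open.
rewrite /seg_set; apply/seteqP; split => x /=; rewrite !in_itv /= andbT.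
  by case.
by case.
Qed.

Definition seg l r : scalC R :=
  Intvl (@seg_is_interval l r) (@seg_bounded l r) (seg_open l r).

(** The largest interval inside [A] on which multiplication by [n] is a morphism
    to [B]; for [n = 1] it is the intersection of [A] and [B]. *)
Definition pull_set A B n : set R := [set x | pts A x /\ pts B (n.* * x)].

Lemma pull_is_interval A B n : is_interval (pull_set A B n).
Proof.
move=> x y [Ax Bx] [Ay By] z /andP[xz zy]; split.
  by apply: (intvl_is_interval Ax Ay); rewrite xz.
by apply: (intvl_is_interval Bx By); rewrite !ler_pM2l ?posr_gt0// xz.
Qed.

Lemma pull_bounded A B n : bounded_set (pull_set A B n).
Proof.
have [M [Mreal AM]] := intvl_bounded A.
by exists M; split=> // x /AM Ax y [/Ax].
Qed.

Lemma pull_open A B n :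
  exists2 U : set R, open U & pull_set A B n = U `&` `[0, +oo[.
Proof.
have [U oU eA] := intvl_open A; have [V oV eB] := intvl_open B.
exists (U `&` ( *%R n.* @^-1` V)).
  apply: openI => //; apply: open_comp => // x _; exact: mulrl_continuous.
apply/seteqP; split => x; rewrite /pull_set /= eA eB /= !in_itv /= !andbT.
  by case=> [[]] ? ? [].
move=> [[Ux Vx] x0]; split => //; split => //.
by rewrite mulr_ge0// ltW// posr_gt0.
Qed.

Definition pull A B n : scalC R :=
  Intvl (@pull_is_interval A B n) (@pull_bounded A B n) (pull_open A B n).

Lemma scal_exists A B n :
  (forall x, pts A x -> pts B (n.* * x)) -> A !=set0 ->
  exists f : @mor (scalC R) A B, scal_mult f = n.
Proof. by move=> nAB A0; exists (ScalMul A0 nAB). Qed.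

Lemma incl_exists A B :
  pts A `<=` pts B -> exists f : @mor (scalC R) A B, scal_mult f = one_posint.
Proof.
move=> AB; have [A0|A0] := pselect (A !=set0).
  by apply: scal_exists => // x /AB; rewrite mul1r.
by exists (ScalEmpty B ((nonemptyPn _).1 A0)).
Qed.

(** * The location of an element *)

Section Germs.
Variable F : functor (scalC R) Sets.
Hypothesis Fpt : is_point F.

(** The empty family covers the empty interval. *)
Lemma inhabited_point A (x : F A) : A !=set0.
Proof.
apply: contrapT => A0; have {}A0 := (nonemptyPn A).1 A0.
have [|i] := Fpt.2 A False (fun=> A) (fun=> idm A) _ x; last by case: i.
by split=> [[]//|]; rewrite A0; apply/seteqP; split => // y [].
Qed.

Lemma fmor_mult A B (f g : mor A B) (x : F A) :
  scal_mult f = scal_mult g -> fmor F f x = fmor F g x.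
Proof. by move=> fg; congr (fmor F _ x); apply: scal_eq. Qed.

Lemma fmor_comp A B D (g : mor B D) (f : mor A B) (x : F A) :
  fmor F g (fmor F f x) = fmor F (cmp g f) x.
Proof. by rewrite fmor_cmp. Qed.

Lemma mult_cmp A B D (g : mor B D) (f : mor A B) (x : F A) :
  scal_mult (cmp g f) = mul_posint (scal_mult g) (scal_mult f).
Proof. by rewrite /= scal_mult_comp//; exact: inhabited_point x. Qed.

Lemma germ_span A B (x : F A) (y : F B) :
  exists D (w : F D) (u : mor D A) (v : mor D B),
    fmor F u w = x /\ fmor F v w = y.
Proof. by case: Fpt => -[_ + _ _]; exact. Qed.

(** Combines the last two clauses of flatness: a common source of [x] and [y] is
    replaced by one that equalizes its two composites to [D].  As its interval
    is nonempty, equality of these composites is equality of multipliers. *)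
Lemma germ_square A B D (f : mor A D) (g : mor B D) (x : F A) (y : F B) :
  fmor F f x = fmor F g y ->
  exists W (w : F W) (u : mor W A) (v : mor W B),
    [/\ fmor F u w = x, fmor F v w = y
      & mul_posint (scal_mult f) (scal_mult u) =
        mul_posint (scal_mult g) (scal_mult v)].
Proof.
move=> fg; have [E [e [u [v [ux vy]]]]] := germ_span x y.
have [[_ _ equ] _] := Fpt.
have [|W [k [w [kw ek]]]] := equ _ _ (cmp f u) (cmp g v) e.
  by rewrite -!fmor_comp ux vy.
exists W, w, (cmp u k), (cmp v k); split.
- by rewrite -fmor_comp kw.
- by rewrite -fmor_comp kw.
- by rewrite -!(mult_cmp _ _ w) !cmpA ek.
Qed.

(** [a] is the limit of the filter of the subintervals of [A] from which [x]
    comes. *)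
Definition located A (x : F A) (a : R) : Prop :=
  pts A a /\ forall B (i : mor B A), scal_mult i = one_posint -> pts B a ->
    exists y, fmor F i y = x.

(** A subinterval of [A] around each [a] of [A] from which [x] does not come
    would be a member of a cover of [A] contradicting continuity. *)
Lemma located_exists A (x : F A) : exists a, located x a.
Proof.
apply: contrapT => /forallNP nloc.
have bad (a : {a : R | pts A a}) :
    exists B (i : mor B A), [/\ scal_mult i = one_posint, pts B (sval a) &
      forall y, fmor F i y <> x].
  apply: contrapT => good; apply: (nloc (sval a)); split; first exact: svalP.
  move=> B i i1 Ba; apply: contrapT => /forallNP hy; apply: good.
  by exists B, i.
pose B a := sval (cid (bad a)).
pose i a : mor (B a) A := sval (cid (svalP (cid (bad a)))).
have iP a : [/\ scal_mult (i a) = one_posint, pts (B a) (sval a) &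
      forall y, fmor F (i a) y <> x].
  exact: svalP (cid (svalP (cid (bad a)))).
have [|a [y]] := Fpt.2 A _ B i _ x; last by case: (iP a) => _ _ /(_ y).
split; first by move=> a; case: (iP a).
apply/seteqP; split => [y [a _]|y Ay].
- move/(scal_mult_in (i a)).
  by case: (iP a) => -> _ _; rewrite mul1r.
- by exists (exist _ y Ay) => //; case: (iP (exist _ y Ay)).
Qed.

Lemma disjoint_intervals (a b : R) : 0 <= a -> 0 <= b -> a != b ->
  exists A B : scalC R, [/\ pts A a, pts B b & forall x, pts A x -> ~ pts B x].
Proof.
wlog ab : a b / a < b.
  move=> H a0 b0; case: (ltgtP a b) => // ab _.
    by apply: H => //; rewrite lt_eqF.
  have [||//|A [B [Aa Bb AB]]] := H b a ab; rewrite ?lt_eqF//.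
  by exists B, A; split=> // x Bx Ax; apply: (AB x).
move=> a0 b0 _; exists (seg (a - 1) ((a + b) / 2)), (seg ((a + b) / 2) (b + 1)).
split=> [||x]; rewrite /= /seg_set /=.
- by split=> //; lra.
- by split=> //; lra.
- by move=> [_ ?] [_ ?]; lra.
Qed.

(** Replaces [A] by an interval [W] so small that multiplication by [n] becomes
    a morphism to [B] that can be applied to [x]. *)
Lemma located_pull A (x : F A) a B n : located x a -> pts B (n.* * a) ->
  exists W (y : F W) (i : mor W A) (j : mor W B),
    [/\ scal_mult i = one_posint, scal_mult j = n & fmor F i y = x].
Proof.
move=> [Aa loc] Ba; set W := pull A B n.
have Wa : pts W a by split.
have [i i1] := incl_exists (A := W) (B := A) (fun y Wy => Wy.1).
have [j jn] : exists j : mor W B, scal_mult j = n.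
  by apply: scal_exists; [move=> y []|exists a].
by have [y yx] := loc _ i i1 Wa; exists W, y, i, j.
Qed.

(** If [x] comes from two intervals, a common source of its two preimages is
    included in both up to the same positive integer, so they are not
    disjoint. *)
Lemma located_unique A (x : F A) a b : located x a -> located x b -> a = b.
Proof.
move=> xa xb; apply/eqP; apply: contrapT => /negP ab.
have [B [D [Ba Db BD]]] := disjoint_intervals (pts_ge0 xa.1) (pts_ge0 xb.1) ab.
have [|V [y [i [i' [i1 i'1 iy]]]]] := @located_pull _ _ _ B one_posint xa.
  by rewrite mul1r.
have [|W [z [j [j' [j1 j'1 jz]]]]] := @located_pull _ _ _ D one_posint xb.
  by rewrite mul1r.
have [|E [w [u [v [_ _]]]]] := @germ_square _ _ _ i j y z.
  by rewrite iy jz.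
rewrite i1 j1 !mul1_posint => uv.
have [c Ec] := inhabited_point w.
have /BD := scal_mult_in i' (scal_mult_in u Ec).
have := scal_mult_in j' (scal_mult_in v Ec).
by rewrite i'1 j'1 uv.
Qed.

Lemma located_fmor A B (f : mor A B) (x : F A) a :
  located x a -> located (fmor F f x) ((scal_mult f).* * a).
Proof.
move=> xa; split; first exact: scal_mult_in xa.1.
move=> D k k1 Da.
have [W [y [i [j [i1 jf <-]]]]] := located_pull xa Da.
exists (fmor F j y); rewrite !fmor_comp; apply: fmor_mult.
by rewrite !(mult_cmp _ _ y) k1 i1 jf mul1_posint mul_posint1.
Qed.

Lemma located_fmor_inv A B (f : mor A B) (x : F A) b :
  located (fmor F f x) b -> exists2 a, located x a & b = (scal_mult f).* * a.
Proof.
move=> fxb; have [a xa] := located_exists x; exists a => //.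
exact: located_unique fxb (located_fmor f xa).
Qed.

(** [y] is the image of [x] under multiplication by [n], as germs: neither a
    morphism from [A] to [B] nor a common interval is assumed, only a common
    source on which the two elements are proportional.  For [n = 1] this
    identifies elements over different intervals that have a common
    restriction. *)
Definition multiple n A B (x : F A) (y : F B) : Prop :=
  exists D (w : F D) (u : mor D A) (v : mor D B),
    [/\ fmor F u w = x, fmor F v w = y
      & scal_mult v = mul_posint n (scal_mult u)].

Lemma multiple_fmor A B (f : mor A B) (x : F A) :
  multiple (scal_mult f) x (fmor F f x).
Proof.
exists A, x, (idm A), f; split=> //; first by rewrite fmor_id.
by rewrite [scal_mult (idm A)]scal_mult_id mul_posint1.
Qed.

(** The two witnesses have images with the same multiplier over a common source,
    so they agree there. *)
Lemma multiple_fun n A B (x : F A) (y y' : F B) :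
  multiple n x y -> multiple n x y' -> y = y'.
Proof.
move=> [D [w [u [v [ux <- e]]]]] [D' [w' [u' [v' [u'x <- e']]]]].
have [|E [z [a [b [<- <- ab]]]]] := @germ_square _ _ _ u u' w w'.
  by rewrite ux u'x.
rewrite !fmor_comp; apply: fmor_mult.
by rewrite !(mult_cmp _ _ z) e e' -!mul_posintA ab.
Qed.

(** Positive integers are cancellable. *)
Lemma multiple_inj n A B (x x' : F A) (y : F B) :
  multiple n x y -> multiple n x' y -> x = x'.
Proof.
move=> [D [w [u [v [<- vy e]]]]] [D' [w' [u' [v' [<- v'y e']]]]].
have [|E [z [a [b [<- <- ab]]]]] := @germ_square _ _ _ v v' w w'.
  by rewrite vy v'y.
rewrite !fmor_comp; apply: fmor_mult; apply: (@mul_posintI n).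
by rewrite !(mult_cmp _ _ z) !mul_posintA -e -e'.
Qed.

Lemma multiple_trans m n A B D (x : F A) (y : F B) (z : F D) :
  multiple n x y -> multiple m y z -> multiple (mul_posint m n) x z.
Proof.
move=> [E [w [u [v [ux vy e]]]]] [E' [w' [u' [v' [u'y v'z e']]]]].
have [|W [t [a [b [aw bw' ab]]]]] := @germ_square _ _ _ v u' w w'.
  by rewrite vy u'y.
exists W, t, (cmp u a), (cmp v' b); rewrite -!fmor_comp aw bw'; split=> //.
by rewrite !(mult_cmp _ _ t) e' -mul_posintA -ab e !mul_posintA.
Qed.

Lemma located_multiple A B (x : F A) n a : located x a -> pts B (n.* * a) ->
  exists y : F B, multiple n x y /\ located y (n.* * a).
Proof.
move=> xa Ba; have [W [y [i [j [i1 jn iy]]]]] := located_pull xa Ba.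
exists (fmor F j y); split.
  by exists W, y, i, j; split=> //; rewrite jn i1 mul_posint1.
have [b yb ab] : exists2 b, located y b & a = (scal_mult i).* * b.
  by apply: located_fmor_inv; rewrite iy.
by move: ab; rewrite i1 mul1r => ->; rewrite -jn; exact: located_fmor.
Qed.

(** Only the germ of [x] at its location matters: [x] can be moved to any other
    interval containing the location. *)
Lemma located_transfer A B (x : F A) a : located x a -> pts B a ->
  exists y : F B, multiple one_posint x y /\ located y a.
Proof.
by move=> xa Ba; have := @located_multiple A B x one_posint a xa;
  rewrite mul1r; exact.
Qed.

End Germs.

(** * Rank one subgroups of the reals *)

Section RankOne.

Lemma subgroup_mulrz (V : zmodType) (K : set V) (x : V) (z : int) :
  is_subgroup K -> K x -> K (x *~ z).
Proof.
move=> Kgrp Kx; case: z => n; first exact: is_subgroup_muln.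
rewrite NegzE mulrNz -sub0r; apply: Kgrp.2; first exact: Kgrp.1.
exact: is_subgroup_muln.
Qed.

Lemma subgroup_add (V : zmodType) (K : set V) (x y : V) :
  is_subgroup K -> K x -> K y -> K (x + y).
Proof.
move=> Kgrp Kx Ky; rewrite -[y]opprK; apply: Kgrp.2 => //.
by rewrite -sub0r; apply: Kgrp.2 => //; exact: Kgrp.1.
Qed.

Lemma additive_mulrz (V W : zmodType) (K : set V) (f : V -> W)
    (x : V) (z : int) :
  is_subgroup K ->
  (forall x y, K x -> K y -> f (x + y) = f x + f y) ->
  K x -> f (x *~ z) = f x *~ z.
Proof.
move=> Kgrp fD Kx.
have f0 : f 0 = 0.
  by apply: (addrI (f 0)); rewrite -fD ?addr0//; exact: Kgrp.1.
have fn (n : nat) : f (x *+ n) = f x *+ n.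
  elim: n => [|n IHn]; first by rewrite !mulr0n.
  by rewrite !mulrS fD ?IHn//; exact: is_subgroup_muln.
case: z => n; first exact: fn.
have Kn : K (x *- n.+1).
  by rewrite -sub0r; apply: Kgrp.2; [exact: Kgrp.1|exact: is_subgroup_muln].
rewrite NegzE !mulrNz -!pmulrn; apply: (addrI (f x *+ n.+1)).
by rewrite subrr -fn -fD ?subrr//; exact: is_subgroup_muln.
Qed.

Lemma posint_of_intr (z : int) : 0 < z -> exists n : posint, z%:~R = n.*.
Proof. by case: z => // n n0; exists (exist _ n n0). Qed.

(** The numerator and denominator of [x / y], with Bezout coefficients. *)
Lemma rat_ratio (x y : rat) : y != 0 ->
  exists p d u v : int, [/\ 0 < d, x *~ d = y *~ p & u * p + v * d = 1].
Proof.
move=> y0; have [u [v e]] := Bezoutz (numq (x / y)) (denq (x / y)).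
exists (numq (x / y)), (denq (x / y)), u, v; split.
- exact: denq_gt0.
- rewrite -[LHS]mulrzr -[RHS]mulrzr numqE mulrA; congr (_ * _).
  by rewrite mulrCA mulfV// mulr1.
- rewrite e; apply/eqP.
  by have := coprime_num_den (x / y); rewrite /gcdz /coprime => /eqP ->.
Qed.

(** The ratio of [f a] and [f b] is a reduced fraction [p / d], so that
    [d a = p b] since [f] is injective; if [u p + v d = 1] then [u a + v b] is a
    common divisor, with [a] and [b] its multiples by [p] and [d]. *)
Lemma rank_one_divisor (H : set R) a b : rank_one H ->
  H a -> H b -> 0 < a -> 0 < b ->
  exists c n m, [/\ H c, 0 < c, a = n.* * c & b = m.* * c].
Proof.
move=> [Hgrp _ [K [f [_ fbij fD]]]] Ha Hb a0 b0.
have finj := set_bij_inj fbij.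
have fz x (z : int) : H x -> f (x *~ z) = f x *~ z by exact: additive_mulrz.
have Hz x (z : int) : H x -> H (x *~ z) by exact: subgroup_mulrz.
have f0 : f 0 = 0 by have := fz _ 0 Ha; rewrite !mulr0z.
have fb0 : f b != 0.
  apply/eqP => fb; have : b = 0.
    by apply: finj; rewrite ?inE ?f0//; exact: Hgrp.1.
  by apply/eqP; rewrite gt_eqF.
have [p [d [u [v [d0 dp uv]]]]] := rat_ratio (f a) fb0.
have {}dp : a *~ d = b *~ p.
  by apply: finj; rewrite ?inE; [exact: Hz|exact: Hz|rewrite !fz].
have p0 : 0 < p.
  have : 0 < b *~ p by rewrite -dp pmulrz_rgt0.
  by rewrite pmulrz_rgt0.
pose c := a *~ u + b *~ v.
have pc : c *~ p = a.
  rewrite /c mulrzDl -!mulrzA [v * _]mulrC [b *~ _]mulrzA -dp -mulrzA -mulrzDr.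
  by rewrite [d * v]mulrC uv.
have dc : c *~ d = b.
  rewrite /c mulrzDl -!mulrzA [u * _]mulrC [a *~ _]mulrzA dp -mulrzA -mulrzDr.
  by rewrite [p * u]mulrC uv.
have [n nE] := posint_of_intr p0; have [m mE] := posint_of_intr d0.
exists c, n, m; split.
- by apply: subgroup_add => //; exact: Hz.
- by rewrite -(pmulrz_lgt0 c p0) pc.
- by rewrite -nE mulrzl pc.
- by rewrite -mE mulrzl dc.
Qed.

Definition int_multiples (S : set R) : set R :=
  [set h | exists z : int, exists2 s, S s & h = s *~ z].

(** Common divisors put every element of the set, hence every integral multiple
    of one, in the rational line through a fixed element [s0]; the coordinate
    on this line embeds the subgroup into the rationals. *)
Lemma rank_one_int_multiples (S : set R) :
  S !=set0 -> (forall s, S s -> 0 < s) ->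
  (forall s t, S s -> S t ->
     exists r n m, [/\ S r, s = n.* * r & t = m.* * r]) ->
  rank_one (int_multiples S).
Proof.
move=> [s0 Ss0] S0 div.
have grp : is_subgroup (int_multiples S).
  split; first by exists 0, s0 => //; rewrite mulr0z.
  move=> x y [z [s Ss ->]] [z' [t St ->]].
  have [r [n [m [Sr -> ->]]]] := div s t Ss St.
  exists ((val n)%:Z * z - (val m)%:Z * z'), r => //.
  by rewrite mulrzBr !mulrzA !mulr_natl -!pmulrn.
have s0n0 : s0 != 0 by rewrite gt_eqF// S0.
have rat_mul h : int_multiples S h -> exists q : rat, h = ratr q * s0.
  move=> [z [s Ss ->]]; have [r [n [m [Sr sE s0E]]]] := div s s0 Ss Ss0.
  exists ((z * (val n)%:Z)%:Q / (val m)%:Q).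
  have m0 : m.* != 0 :> R by rewrite gt_eqF// posr_gt0.
  rewrite s0E sE fmorph_div /= !ratr_int -!pmulrn.
  rewrite -mulrzr intrM -!pmulrn mulrA divfK//.
  by rewrite mulrC mulrA.
pose f h := xget 0 [set q : rat | h = ratr q * s0].
have fE h : int_multiples S h -> h = ratr (f h) * s0.
  by move=> /rat_mul [q hq]; rewrite /f; case: xgetP => [q' _ //|/(_ q)].
have finj (q q' : rat) : ratr q * s0 = ratr q' * s0 -> q = q'.
  by move/(mulIf s0n0)/fmorph_inj.
have fD x y : int_multiples S x -> int_multiples S y -> f (x + y) = f x + f y.
  move=> Hx Hy; apply: finj; rewrite rmorphD mulrDl -!fE//.
  exact: subgroup_add.
have fB x y : int_multiples S x -> int_multiples S y -> f (x - y) = f x - f y.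
  move=> Hx Hy; apply: finj; rewrite rmorphB mulrBl -!fE//.
  exact: grp.2.
split=> //.
  move=> e; have : int_multiples S s0 by exists 1, s0.
  by rewrite e /= => /eqP; rewrite (negPf s0n0).
exists (f @` int_multiples S), f; split=> //.
  split.
    exists 0; first exact: grp.1.
    by apply: finj; rewrite -fE ?rmorph0 ?mul0r//; exact: grp.1.
  move=> _ _ [x Hx <-] [y Hy <-]; exists (x - y); [exact: grp.2|exact: fB].
split=> //.
move=> x y; rewrite !inE => Hx Hy e.
by rewrite (fE _ Hx) e -fE.
Qed.

Lemma int_multiples_gt0 (S : set R) :
  (forall s, S s -> 0 < s) -> (forall s n, S s -> S (n.* * s)) ->
  forall x, S x <-> int_multiples S x /\ 0 < x.
Proof.
move=> S0 Sn x; split=> [Sx|[[z [s Ss ->]]]].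
  by split; [exists 1, x|exact: S0].
rewrite pmulrz_rgt0 ?S0// => /posint_of_intr [n nE].
by rewrite -mulrzl nE; exact: Sn.
Qed.

End RankOne.

(** * Locations and support of a point *)

Section PointSupport.
Variable F : functor (scalC R) Sets.
Hypothesis Fpt : is_point F.

Definition location (s : R) : Prop := exists A (x : F A), located x s.

Lemma location_ge0 s : location s -> 0 <= s.
Proof. by case=> A [x [/pts_ge0]]. Qed.

Lemma location_support s : location s -> pt_support F s.
Proof.
move=> [A [x xs]]; split=> /=.
  by rewrite in_itv /= andbT; exact: pts_ge0 xs.1.
move=> [B FB Bs]; apply: FB.
by have [y _] := located_transfer Fpt xs Bs; constructor.
Qed.

(** The support is in general only the closure of the set of locations, so [s]
    itself need not be one. *)
Lemma support_location s :
  pt_support F s -> 0 < s -> exists2 t, location t & 0 < t.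
Proof.
move=> [_ Fs] s0; pose A : scalC R := seg (s / 2) (s + 1).
have [[x]|FA] := pselect (inhabited (F A)).
  have [t xt] := located_exists Fpt x; exists t; first by exists _, x.
  by have [_ /= /andP[+ _]] := xt.1; apply: lt_trans; rewrite divr_gt0.
by exfalso; apply: Fs; exists A => //; split; [exact: ltW|lra].
Qed.

Lemma location_exists : exists s, location s.
Proof.
have [[[A [x]] _ _] _] := Fpt.
by have [s xs] := located_exists Fpt x; exists s, A, x.
Qed.

Lemma support0_location :
  pt_support F = [set 0] <-> forall s, location s -> s = 0.
Proof.
split=> [e s /location_support|s0]; first by rewrite e.
apply/seteqP; split => [s Fs|_ ->] /=.
  have [+ _] := Fs; rewrite /= in_itv /= andbT le_eqVlt => /orP[/eqP//|s_gt0].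
  have [t /s0 -> ] := support_location Fs s_gt0.
  by rewrite ltxx.
by have [s Fs] := location_exists; rewrite -(s0 s Fs); exact: location_support.
Qed.

Lemma location_mul s n : location s -> location (n.* * s).
Proof.
move=> [A [x xs]]; have ns : pts (seg (- 1) (n.* * s + 1)) (n.* * s).
  have : 0 <= n.* * s by rewrite mulr_ge0 ?(pts_ge0 xs.1)// ltW// posr_gt0.
  by split => //; lra.
by have [y [_ ys]] := located_multiple Fpt xs ns; exists _, y.
Qed.

Lemma located_span A B (x : F A) (y : F B) s t :
  located x s -> located y t ->
  exists D (w : F D) (u : mor D A) (v : mor D B) r,
    [/\ located w r, fmor F u w = x, fmor F v w = y,
        s = (scal_mult u).* * r & t = (scal_mult v).* * r].
Proof.
move=> xs yt; have [D [w [u [v [ux vy]]]]] := germ_span Fpt x y.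
have [r wr] := located_exists Fpt w.
exists D, w, u, v, r; split=> //.
- by apply: (located_unique Fpt xs); rewrite -ux; exact: located_fmor.
- by apply: (located_unique Fpt yt); rewrite -vy; exact: located_fmor.
Qed.

Lemma location_divisor s t : location s -> location t ->
  exists r n m, [/\ location r, s = n.* * r & t = m.* * r].
Proof.
move=> [A [x xs]] [B [y yt]].
have [D [w [u [v [r [wr _ _ -> ->]]]]]] := located_span xs yt.
by exists r, (scal_mult u), (scal_mult v); split=> //; exists D, w.
Qed.

(** A nonzero location and [s] are positive multiples of a common location,
    which is then nonzero. *)
Lemma location_gt0 : pt_support F <> [set 0] -> forall s, location s -> 0 < s.
Proof.
move=> Fn0 s Fs.
have [t Ft t0] : exists2 t, location t & t != 0.
  apply: contrapT => h; apply: Fn0; apply/support0_location => t Ft.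
  by apply/eqP; apply: contrapT => /negP t0; apply: h; exists t.
have [r [n [m [Fr -> tE]]]] := location_divisor Fs Ft.
rewrite mulr_gt0 ?posr_gt0// lt_neqAle location_ge0// andbT eq_sym.
by apply: contra_neq t0 => r0; rewrite tE r0 mulr0.
Qed.

(** Over a common source located at [r > 0], the multipliers leading to [x] and
    to [y] are both [s / r]. *)
Lemma located_inj A (x y : F A) s :
  0 < s -> located x s -> located y s -> x = y.
Proof.
move=> s0 xs ys.
have [D [w [u [v [r [wr <- <- su sv]]]]]] := located_span xs ys.
apply: fmor_mult; apply: val_inj; apply/eqP; rewrite -(eqr_nat R).
have r0 : r != 0 by apply: contraTneq s0 => r0; rewrite su r0 mulr0 ltxx.
by apply/eqP/(mulIf r0); rewrite -su.
Qed.

Definition location_group : set R := int_multiples location.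

Lemma location_group_rank_one :
  pt_support F <> [set 0] -> rank_one location_group.
Proof.
move=> Fn0; apply: rank_one_int_multiples; first exact: location_exists.
- exact: location_gt0.
- exact: location_divisor.
Qed.

Lemma location_groupP : pt_support F <> [set 0] ->
  forall s, location s <-> location_group s /\ 0 < s.
Proof.
move=> Fn0; apply: int_multiples_gt0; first exact: location_gt0.
by move=> s n; exact: location_mul.
Qed.

Lemma trace_location_group (Fn0 : pt_support F <> [set 0]) :
  @isomorphic (functor_cat (scalC R) Sets)
    (trace (exist _ location_group (location_group_rank_one Fn0))) F.
Proof.
apply: (@isomorphic_of_graph _ (trace _) F (fun A h x => located x (sval h))).
- move=> A [h [/= Hh h0 Ah]].
  have [B [y yh]] : location h by apply/location_groupP.
  by have [x [_ xh]] := located_transfer Fpt yh Ah; exists x.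
- move=> A x; have [s xs] := located_exists Fpt x.
  have /location_groupP [//|Hs s0] : location s by exists A, x.
  by exists (exist _ s (And3 Hs s0 xs.1)).
- by move=> A [h [/= Hh h0 Ah]] x y; exact: located_inj.
- move=> A h k x xh xk; apply: fiber_eq.
  exact: (located_unique Fpt xh xk).
- by move=> A B f h x; exact: located_fmor.
Qed.

End PointSupport.

(** * Points with support different from zero *)

Section TraceFunctor.

Lemma rank_one_gt0 (H : set R) : rank_one H -> exists2 h, H h & 0 < h.
Proof.
move=> [Hgrp Hn0 _].
have [h Hh h0] : exists2 h, H h & h != 0.
  apply: contrapT => Hnex; apply: Hn0; apply/seteqP; split => [h Hh|_ ->].
    by apply/eqP; apply: contrapT => /negP h0; apply: Hnex; exists h.
  exact: Hgrp.1.
have [h_gt0|] := ltP 0 h; first by exists h.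
rewrite le_eqVlt (negPf h0) /= => h_lt0; exists (- h); last by rewrite oppr_gt0.
by rewrite -sub0r; apply: Hgrp.2 => //; exact: Hgrp.1.
Qed.

Lemma seg_nbhs (a : R) : 0 <= a -> pts (seg (a - 1) (a + 1)) a.
Proof. by move=> a0; split=> //; lra. Qed.

Lemma common_interval A B (a : R) n m :
  0 <= a -> pts A (n.* * a) -> pts B (m.* * a) ->
  exists W (u : mor W A) (v : mor W B),
    [/\ pts W a, scal_mult u = n & scal_mult v = m].
Proof.
move=> a0 Aa Ba; pose W := pull (pull (seg (a - 1) (a + 1)) A n) B m.
have Wa : pts W a by do !split => //; exact: (seg_nbhs a0).2.
have [|u un] := @scal_exists W A n _ (ex_intro _ a Wa); first by move=> x [[]].
have [|v vm] := @scal_exists W B m _ (ex_intro _ a Wa); first by move=> x [[]].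
by exists W, u, v.
Qed.

Lemma trace_point (H : rank_one_subgroups R) : is_point (trace H).
Proof.
case: H => H H1; split; first split.
- have [h Hh h0] := rank_one_gt0 H1.
  exists (seg (h - 1) (h + 1)); constructor; exists h; split=> //.
  by apply: seg_nbhs; exact: ltW.
- move=> A B [x [Hx x0 Ax]] [y [Hy y0 By]].
  have [c [n [m [Hc c0 xE yE]]]] := rank_one_divisor H1 Hx Hy x0 y0.
  have [||W [u [v [Wc un vm]]]] := @common_interval A B c n m (ltW c0).
  + by rewrite -xE.
  + by rewrite -yE.
  exists W, (exist _ c (And3 Hc c0 Wc)), u, v.
  by split; apply: fiber_eq => /=; rewrite ?un ?vm.
- move=> A B u v x /(congr1 sval) /= uv; exists A, (idm A), x.
  split; first exact: (congr1 (@^~ x) (fmor_id (trace _) A)).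
  apply: (congr1 (fun f => cmp f (idm A))); apply: scal_eq => _.
  case: x uv => x [/= _ x0 _] /(mulIf (lt0r_neq0 x0)) /eqP.
  by rewrite eqr_nat => /eqP uv; exact: val_inj.
- move=> A I U u [u1 UA] [x [/= Hx x0 Ax]].
  have [i _ Ux] : (\bigcup_i (U i : set R)) x by rewrite UA.
  exists i, (exist _ x (And3 Hx x0 Ux)).
  by apply: fiber_eq; rewrite /= u1 mul1r.
Qed.

Lemma trace_support (H : rank_one_subgroups R) :
  pt_support (trace H) <> [set 0].
Proof.
case: H => H H1 e; have [h Hh h0] := rank_one_gt0 H1.
have : [set 0] h; last by move=> /= h00; move: h0; rewrite h00 ltxx.
rewrite -e; split; first by rewrite /= in_itv /= andbT ltW.
by move=> [A HA Ah]; apply: HA; constructor; exists h.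
Qed.

Definition trace_points :
    functor (rank_one_subgroups R) (points_support_neq0 R) :=
  @Functor (rank_one_subgroups R) (points_support_neq0 R)
    (fun H => exist _ (trace H) (conj (trace_point H) (@trace_support H)))
    (fun H K HK => trace_trans HK)
    (fun H => trace_trans_id H) (fun H K L g f => trace_trans_cmp g f).

(** If [t] moved [x], restricting [x] to a neighbourhood that avoids its image
    would contradict naturality for the inclusion of that neighbourhood. *)
Lemma trace_rigid (H K : rank_one_subgroups R)
    (t : nattrans (trace H) (trace K)) A (x : trace H A) :
  sval (t A x) = sval x.
Proof.
apply/eqP; apply: contrapT => /negP tx.
have [_ x0 Ax] := svalP x; have [_ y0 Ay] := svalP (t A x).
have [B [D [By Dx BD]]] := disjoint_intervals (ltW y0) (ltW x0) tx.
have [||W [u [v [Wx u1 v1]]]] :=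
  @common_interval A D (sval x) one_posint one_posint (ltW x0);
  rewrite ?mul1r//.
have [Hx _ _] := svalP x.
pose z : trace H W := exist _ (sval x) (And3 Hx x0 Wx).
have zx : fmor (trace H) u z = x by apply: fiber_eq; rewrite /= u1 mul1r.
have tzx : sval (t W z) = sval (t A x).
  have := congr1 (fun k => sval (k z)) (ntc_natural t u).
  by rewrite /= u1 mul1r => <-; rewrite -[in RHS]zx.
have [_ _ /(scal_mult_in v)] := svalP (t W z).
by rewrite v1 mul1r tzx => /(BD _ By).
Qed.

Lemma trace_trans_sub (H K : rank_one_subgroups R) :
  nattrans (trace H) (trace K) -> sval H `<=` sval K.
Proof.
move=> t; have pos h : sval H h -> 0 < h -> sval K h.
  move=> Hh h0; have h1 := seg_nbhs (ltW h0).
  have [+ _ _] := svalP (t _ (exist _ h (And3 Hh h0 h1))).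
  by rewrite trace_rigid.
move=> h Hh; have [Kgrp _ _] := svalP K; have [Hgrp _ _] := svalP H.
case: (ltgtP h 0) => [h0|h0|->]; last exact: Kgrp.1; last exact: pos.
rewrite -[h]opprK -sub0r; apply: Kgrp.2; first exact: Kgrp.1.
apply: pos; last by rewrite oppr_gt0.
by rewrite -sub0r; apply: Hgrp.2 => //; exact: Hgrp.1.
Qed.

Lemma trace_points_equivalence : is_equivalence trace_points.
Proof.
apply: equivalence_of_fully_faithful.
- by move=> H K f g _; exact: (@Prop_irrelevance (sval H `<=` sval K)).
- move=> H K t; exists (trace_trans_sub t); apply: nattrans_eq => A.
  by apply/funext => x; apply: fiber_eq; rewrite /= trace_rigid.
- move=> [F [Fpt Fn0]].
  exists (exist _ _ (location_group_rank_one Fpt Fn0)).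
  exact: trace_location_group.
Qed.

End TraceFunctor.

(** * Points with support zero *)

Section AtZeroFunctor.

Definition seg01 : scalC R := seg (- 1) 1.

Lemma zero_seg01 : pts seg01 0.
Proof. by split=> //; rewrite oppr_lt0 ltr01. Qed.

(** Elements of [X] are elements over [seg01].  To equalize [m] and [n], they
    are regarded over an interval short enough for both multiplications to be
    morphisms to [seg01]. *)
Lemma flat_at_zero (X : functor Ntimes Sets) : flat (at_zero R X) -> flat X.
Proof.
move=> [[A [[x0 _]]] joint equ]; split.
- by exists tt.
- move=> [] [] x y.
  have [W [[w _] [u [v [/(congr1 sval) /= <- /(congr1 sval) /= <-]]]]] :=
    joint seg01 seg01 (exist _ x zero_seg01) (exist _ y zero_seg01).
  by exists tt, w, (scal_mult u), (scal_mult v).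
- move=> [] [] m n x mn.
  have [||W [f [g [W0 fm gn]]]] := @common_interval seg01 seg01 0 m n (lexx 0).
  + by rewrite mulr0; exact: zero_seg01.
  + by rewrite mulr0; exact: zero_seg01.
  have [|D [w [[z D0] [/(congr1 sval) /= wz fg]]]] :=
    equ _ _ f g (exist _ x W0).
    by apply: fiber_eq; rewrite /= fm gn.
  exists tt, (scal_mult w), z; split=> //.
  have Dn : D !=set0 by exists 0.
  by have /= := congr1 (@scal_mult R _ _) fg; rewrite !scal_mult_comp// fm gn.
Qed.

Lemma at_zero_point (X : functor Ntimes Sets) :
  flat X -> is_point (at_zero R X).
Proof.
move=> [[[] [x0]] joint equ]; split; first split.
- by exists seg01; constructor; exists x0; exact: zero_seg01.
- move=> A B [y A0] [z B0].
  have [[] [w [n [m [/= ny mz]]]]] := joint tt tt y z.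
  have [||W [u [v [W0 un vm]]]] := @common_interval A B 0 n m (lexx 0);
    rewrite ?mulr0//.
  exists W, (exist _ w W0), u, v.
  by split; apply: fiber_eq; rewrite /= ?un ?vm.
- move=> A B u v [y A0] /(congr1 sval) /= uv.
  have [[] [n [z [nz e]]]] := equ tt tt (scal_mult u) (scal_mult v) y uv.
  exists A, (idm A), (exist _ y A0); split.
    exact: (congr1 (@^~ _) (fmor_id (at_zero R X) A)).
  apply: (congr1 (fun f => cmp f (idm A))); apply: scal_eq => _.
  by apply: (@mul_posintI n); rewrite mul_posintC [RHS]mul_posintC.
- move=> A I U u [u1 UA] [y A0].
  have [i _ U0] : (\bigcup_i (U i : set R)) 0 by rewrite UA.
  exists i, (exist _ y U0); apply: fiber_eq; rewrite /= u1.
  exact: (congr1 (@^~ _) (fmor_id X tt)).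
Qed.

Lemma at_zero_support (X : functor Ntimes Sets) :
  flat X -> pt_support (at_zero R X) = [set 0].
Proof.
move=> Xflat; have Xpt := at_zero_point Xflat.
apply/(support0_location Xpt) => s [A [x xs]].
apply/eqP; apply: contrapT => /negP s0.
have [B [D [Bs D0 BD]]] := disjoint_intervals (pts_ge0 xs.1) (lexx 0) s0.
have [[z B0] _] := located_transfer Xpt xs Bs.
exact: BD B0 D0.
Qed.

Definition at_zero_points : functor Ntimes_points (points_support0 R) :=
  @Functor Ntimes_points (points_support0 R)
    (fun X => exist _ (at_zero R (sval X))
       (conj (at_zero_point (svalP X)) (at_zero_support (svalP X))))
    (fun X Y t => at_zero_trans R t)
    (fun X => at_zero_trans_id R (sval X))
    (fun X Y Z t s => at_zero_trans_cmp R t s).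

Section Full.
Variables (X Y : functor Ntimes Sets).
Variable t : nattrans (at_zero R X) (at_zero R Y).

Definition at_seg01 (x : X tt) : at_zero R X seg01 := exist _ x zero_seg01.

(** A transformation is determined by its component on [seg01], because every
    interval containing zero shares with it a smaller one. *)
Lemma at_zero_full : exists s : nattrans X Y, at_zero_trans R s = t.
Proof.
pose s (x : X tt) : Y tt := sval (t seg01 (at_seg01 x)).
have fmor1 (Z : functor Ntimes Sets) (z : Z tt) :
    @fmor _ _ Z tt tt one_posint z = z.
  exact: (congr1 (@^~ _) (fmor_id Z tt)).
have tN A B (f : mor A B) x :
    sval (t B (fmor (at_zero R X) f x)) =
    @fmor _ _ Y tt tt (scal_mult f) (sval (t A x)).
  exact: (congr1 (fun k => sval (k x)) (ntc_natural t f)).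
have tE A (x : at_zero R X A) : sval (t A x) = s (sval x).
  case: x => x A0.
  have [||W [u [v [W0 u1 v1]]]] :=
    @common_interval A seg01 0 one_posint one_posint (lexx 0).
  - by rewrite mulr0.
  - by rewrite mulr0; exact: zero_seg01.
  pose z : at_zero R X W := exist _ x W0.
  have zx : fmor (at_zero R X) u z = exist _ x A0.
    by apply: fiber_eq; rewrite /= u1 fmor1.
  have zx' : fmor (at_zero R X) v z = at_seg01 x.
    by apply: fiber_eq; rewrite /= v1 fmor1.
  by rewrite /s /= -zx -zx' tN u1 -v1; exact/esym/tN.
have sN (a b : Ntimes) (f : mor a b) :
    cmp (match b return mor (X b) (Y b) with tt => s end) (fmor X f) =
    cmp (fmor Y f) (match a return mor (X a) (Y a) with tt => s end).
  case: a b f => [] [] n; apply/funext => x /=.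
  have [||W [u [v [W0 un v1]]]] :=
    @common_interval seg01 seg01 0 n one_posint (lexx 0).
  - by rewrite mulr0; exact: zero_seg01.
  - by rewrite mulr0; exact: zero_seg01.
  have := tN _ _ u (exist _ x W0).
  by rewrite !tE /= un.
exists (@NatTrans _ _ X Y _ sN); apply: nattrans_eq => A.
by apply/funext => x; apply: fiber_eq; rewrite /= tE.
Qed.

End Full.

Section Germs0.
Variable F : functor (scalC R) Sets.
Hypotheses (Fpt : is_point F) (F0 : pt_support F = [set 0]).

Lemma located0 A (x : F A) : located x 0.
Proof.
have [s xs] := located_exists Fpt x.
by rewrite -((support0_location Fpt).1 F0 s) //; exists A, x.
Qed.

Lemma multiple_exists A B (x : F A) n :
  pts B 0 -> exists y : F B, multiple n x y.
Proof.
move=> B0; have [|y [xy _]] := @located_multiple F Fpt A B x n 0 (located0 x).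
  by rewrite mulr0.
by exists y.
Qed.

(** Multiplication by [n] maps [seg01] to an [n] times longer interval; the
    product must then be restricted to [seg01] again. *)
Definition germ_mul (n : posint) (x : F seg01) : F seg01 :=
  sval (cid (multiple_exists x n zero_seg01)).

Lemma germ_mulP n x : multiple n x (germ_mul n x).
Proof. exact: (svalP (cid (multiple_exists x n zero_seg01))). Qed.

Lemma multiple_refl A (x : F A) : multiple one_posint x x.
Proof.
have := multiple_fmor (idm A) x.
by rewrite fmor_id [scal_mult (idm A)]scal_mult_id.
Qed.

Lemma germ_mul_id : germ_mul one_posint = id.
Proof.
apply/funext => x; apply: (multiple_fun Fpt (germ_mulP _ x)).
exact: multiple_refl.
Qed.

Lemma germ_mul_cmp n m : germ_mul (mul_posint n m) = germ_mul n \o germ_mul m.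
Proof.
apply/funext => x; apply: (multiple_fun Fpt (germ_mulP _ x)).
by apply: (multiple_trans Fpt); exact: germ_mulP.
Qed.

Definition germs0 : functor Ntimes Sets :=
  @Functor Ntimes Sets (fun _ => F seg01) (fun _ _ n => germ_mul n)
    (fun _ => germ_mul_id) (fun _ _ _ n m => germ_mul_cmp n m).

(** An element over [seg01] corresponds to the element over [A] with the same
    restriction to their intersection. *)
Lemma at_zero_germs0 :
  @isomorphic (functor_cat (scalC R) Sets) (at_zero R germs0) F.
Proof.
apply: (@isomorphic_of_graph _ (at_zero R germs0) F
  (fun A x y => multiple one_posint (sval x : F seg01) y)).
- by move=> A [x A0]; exact: multiple_exists.
- move=> A y; have [x yx] := multiple_exists y one_posint zero_seg01.
  have [z xz] := multiple_exists x one_posint (located0 y).1.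
  exists (exist _ x (located0 y).1) => /=.
  suff -> : y = z by [].
  apply: (multiple_fun Fpt (multiple_refl y)).
  by have := multiple_trans Fpt yx xz; rewrite mul1_posint.
- by move=> A x y y'; exact: multiple_fun.
- move=> A x x' y xy x'y; apply: fiber_eq; exact: (multiple_inj Fpt xy x'y).
- move=> A B f [x A0] y /= xy.
  have [z nxz] := multiple_exists (germ_mul (scal_mult f) x) one_posint
    (scal_zero_in f A0).
  suff -> : fmor F f y = z by [].
  apply: (multiple_fun Fpt) (multiple_trans Fpt (germ_mulP _ _) nxz).
  have := multiple_trans Fpt xy (multiple_fmor f y).
  by rewrite mul_posint1 mul1_posint.
Qed.

Lemma germs0_flat : flat germs0.
Proof. exact/flat_at_zero/(flat_isomorphic at_zero_germs0)/Fpt.1. Qed.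

End Germs0.

Lemma at_zero_points_equivalence : is_equivalence at_zero_points.
Proof.
apply: equivalence_of_fully_faithful.
- move=> X Y s t st; apply: nattrans_eq => -[]; apply/funext => x.
  pose ev (k : nattrans (at_zero R (sval X)) (at_zero R (sval Y))) :=
    sval (k seg01 (at_seg01 x)).
  exact: (congr1 ev st).
- by move=> X Y t; exact: at_zero_full.
- move=> [F [Fpt F0]].
  by exists (exist _ _ (germs0_flat Fpt F0)); exact: at_zero_germs0.
Qed.

End AtZeroFunctor.

End Scaling.

(** The proofs of functoriality are the only difference between the functors
    constructed above and their images among all set-valued functors. *)
Lemma isomorphic_same_maps (C D : category) (F : C -> D)
    (f : forall a b, mor a b -> mor (F a) (F b)) id1 id2 cmp1 cmp2 :
  @isomorphic (functor_cat C D) (@Functor C D F f id1 cmp1)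
    (@Functor C D F f id2 cmp2).
Proof.
rewrite (Prop_irrelevance id1 id2) (Prop_irrelevance cmp1 cmp2).
by exists (idm _), (idm _); rewrite cmp_idl.
Qed.

Theorem theorem3p1 (R : realType) :
  (exists E : functor Ntimes_points (points_support0 R),
     is_equivalence E /\
     @isomorphic (functor_cat Ntimes_points (functor_cat (scalC R) Sets))
       (comp_functor (full_inclusion _) E)
       (comp_functor (at_zero_functor R) (full_inclusion _)))
  /\
  (exists E : functor (rank_one_subgroups R) (points_support_neq0 R),
     is_equivalence E /\
     @isomorphic (functor_cat (rank_one_subgroups R) (functor_cat (scalC R) Sets))
       (comp_functor (full_inclusion _) E)
       (trace_functor R)).
Proof.
split.
- exists (at_zero_points R); split; first exact: at_zero_points_equivalence.
  exact: isomorphic_same_maps.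
- exists (trace_points R); split; first exact: trace_points_equivalence.
  exact: isomorphic_same_maps.
Qed.
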